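(* Let $m,n\ge 1$ be integers. The number of directed Hamiltonian paths in the complete $m$-partite graph $K_{n,n,\dots,n}$ ($m$ parts, each of size $n$) equals $$n!^{\,m}\,m!\,(-1)^{nm}\sum_{k=m}^{nm}(-1)^k B_{k,m}\left(\left\{\binom{n-1}{i-1}\right\}_{i=1}^{k-m+1}\right).$$
   Context: $B_{k,m}(x_1,\dots,x_{k-m+1})$ denotes the partial (exponential) Bell polynomial, defined by $\frac{1}{m!}\left(\sum_{j\ge1}x_j\frac{t^j}{j!}\right)^m=\sum_{k\ge m}B_{k,m}(x_1,\dots,x_{k-m+1})\frac{t^k}{k!}$; in the formula it is evaluated at $x_i=\binom{n-1}{i-1}$. A directed Hamiltonian path is a directed path visiting every vertex exactly once; a path with at least two vertices and its reversal are counted as different, and in a one-vertex graph the single vertex counts as one such path. For $m=1$ the graph is edgeless. *)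

(* Defs.v *)
From mathcomp Require Import all_boot all_order all_algebra.

Set Implicit Arguments.
Unset Strict Implicit.
Unset Printing Implicit Defensive.

Import GRing.Theory.
Local Open Scope ring_scope.

(* The series sum_(j >= 1) x_j t^j / j!, truncated after t^N; x 0 is unused. *)
Definition egf_trunc (N : nat) (x : nat -> rat) : {poly rat} :=
  \sum_(1 <= j < N.+1) (x j / j`!%:R) *: 'X^j.

(* k! [t^k] (1/m!) (sum_(j >= 1) x_j t^j / j!)^m. Terms of the inner series   *)
(* beyond t^k do not contribute to [t^k] (see bell_generating), and only      *)
(* x 1, ..., x (k - m + 1) matter when m <= k (see bell_eq).                  *)
Definition bell (k m : nat) (x : nat -> rat) : rat :=
  k`!%:R * (m`!%:R^-1 *: egf_trunc k x ^+ m)`_k.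

Definition complete_multipartite (m n : nat) : rel ('I_m * 'I_n) :=
  fun u v => u.1 != v.1.

(* For a one-vertex graph the condition sorted e p is vacuous. *)
Definition directed_hamiltonian_paths (T : finType) (e : rel T) :
    {set #|T|.-tuple T} :=
  [set p : #|T|.-tuple T | sorted e p & [forall v : T, count_mem v p == 1%N]].

Lemma coef_exp_eq (p q : {poly rat}) (d m : nat) :
  (forall j, (j <= d)%N -> p`_j = q`_j) -> (p ^+ m)`_d = (q ^+ m)`_d.
Proof.
elim: m d => [|m IHm] d pq; first by rewrite !expr0.
rewrite !exprS !coefM; apply: eq_bigr => i _.
rewrite pq ?leq_ord // IHm // => j jd; apply: pq.
exact: leq_trans jd (leq_subr _ _).
Qed.

Lemma egf_truncE (N : nat) (x : nat -> rat) :
  egf_trunc N x = 'X * \poly_(j < N) (x j.+1 / j.+1`!%:R).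
Proof.
rewrite /egf_trunc big_add1 /= big_mkord poly_def mulr_sumr.
by apply: eq_bigr => i _; rewrite -scalerAr -exprS.
Qed.

Lemma coef_egf_exp (N m k : nat) (x : nat -> rat) :
  (egf_trunc N x ^+ m)`_k =
  if (k < m)%N then 0 else ((\poly_(j < N) (x j.+1 / j.+1`!%:R)) ^+ m)`_(k - m).
Proof. by rewrite egf_truncE exprMn coefXnM. Qed.

(* The defining identity of the partial Bell polynomials, modulo t^(N+1) for *)
(* every N.                                                                  *)
Lemma bell_generating (N m k : nat) (x : nat -> rat) : (k <= N)%N ->
  (m`!%:R^-1 *: egf_trunc N x ^+ m)`_k = bell k m x / k`!%:R.
Proof.
move=> kN; rewrite /bell mulrAC mulfV ?mul1r; last first.
  by rewrite Num.Theory.pnatr_eq0 -lt0n fact_gt0.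
rewrite !coefZ; congr (_ * _); apply: coef_exp_eq => j jk.
rewrite !egf_truncE !coefXM !coef_poly; case: j jk => //= j jk.
by rewrite jk (leq_trans jk kN).
Qed.

Lemma bell_eq (k m : nat) (x y : nat -> rat) :
  (forall i, (1 <= i <= k - m + 1)%N -> x i = y i) -> bell k m x = bell k m y.
Proof.
move=> xy; rewrite /bell !coefZ !coef_egf_exp; case: ltnP => // mk.
congr (_ * (_ * _)); apply: coef_exp_eq => j jk.
by rewrite !coef_poly xy //= addn1 ltnS.
Qed.

(* Main.v *)
(* Let [L] be the linear functional on polynomials with [L(t^k) = k!], that   *)
(* is [L(p) = int_0^oo p(t) e^-t dt], so that [L(p) = p(0) + L(p')]. Put      *)
(* [q_0 = 1] and [q_n = sum_(j >= 1) (-1)^(n-j) C(n-1,j-1) t^j / j!]. Pascal's *)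
(* rule gives [q_(n+1)' = q_n - q_n']. Therefore, by induction on the number  *)
(* of vertices, the Hamiltonian paths on a vertex set with [c_j] vertices of  *)
(* colour [j], no two consecutive ones of the same colour, number             *)
(* [prod_j c_j! * L(prod_j q_(c_j))], and those whose first vertex must also  *)
(* avoid colour [i] number                                                    *)
(* [prod_j c_j! * L((q_(c_i) - q_(c_i)') prod_(j <> i) q_(c_j))]: splitting   *)
(* on the first vertex amounts to applying [L(p) = p(0) + L(p')] and Leibniz' *)
(* rule to the product. Expanding [L(q_n^m)] yields the Bell polynomials.     *)

Require Import Defs.
From HB Require Import structures.
From mathcomp Require Import all_boot all_order all_algebra ring.

Set Implicit Arguments.
Unset Strict Implicit.
Unset Printing Implicit Defensive.

Import GRing.Theory Num.Theory.
Local Open Scope ring_scope.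

(** The recursion above is carried by [deriv_lagS] and [sum_lag_prod_rem]; [count_path] is the form
    with a prescribed preceding vertex in which the induction closes, and [count_sorted] drops that
    vertex. For [m] colours with [n] vertices each the count is [L (lag n ^+ m)]. As [lag n] is
    [n! (-1)^n] times the series of the [C(n-1, i-1) t^i / i!] taken at [-t], the coefficient of
    [t^k] in its [m]-th power is [n!^m (-1)^(nm) (-1)^k m! B_(k,m) / k!], and [L] cancels the [k!].
    Up to the factor [(-1)^n n!], [lag n] is the generalized Laguerre polynomial of degree [n] with
    parameter [-1]. *)

Lemma factSr (n : nat) : n.+1`!%:R = n.+1%:R * n`!%:R :> rat.
Proof. by rewrite factS natrM. Qed.

Lemma fact_neq0 (n : nat) : n`!%:R != 0 :> rat.
Proof. by rewrite pnatr_eq0 -lt0n fact_gt0. Qed.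

Definition factorial_functional (p : {poly rat}) : rat :=
  \sum_(i < size p) p`_i * i`!%:R.

Local Notation L := factorial_functional.

Lemma factorial_functional_widen (N : nat) (p : {poly rat}) :
  (size p <= N)%N -> L p = \sum_(i < N) p`_i * i`!%:R.
Proof.
move=> pN; rewrite /L (big_ord_widen N (fun i => p`_i * i`!%:R) pN).
rewrite big_mkcond; apply: eq_bigr => i _; case: ltnP => // le_p_i.
by rewrite nth_default ?mul0r.
Qed.

Lemma factorial_functional_linear : linear (L : {poly rat} -> rat^o).
Proof.
move=> a p q; set N := maxn (size p) (size q).
have szE : (size (a *: p + q)%R <= N)%N.
  apply: leq_trans (size_polyD _ _) _.
  by rewrite geq_max !leq_max leqnn (leq_trans (size_scale_leq _ _)) ?orbT.
rewrite (factorial_functional_widen szE).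
rewrite (@factorial_functional_widen N p) ?leq_maxl //.
rewrite (@factorial_functional_widen N q) ?leq_maxr //.
rewrite scaler_sumr -big_split /=; apply: eq_bigr => i _.
by rewrite coefD coefZ mulrDl -mulrA.
Qed.

HB.instance Definition _ :=
  GRing.isLinear.Build rat {poly rat} rat^o _ L factorial_functional_linear.

(** Integration by parts, read off coefficients: the factor [i+1] of [(i+1)!] is the one produced by
    differentiating [t^(i+1)]. *)
Lemma factorial_functional_deriv (p : {poly rat}) : L p = p`_0 + L p^`().
Proof.
rewrite (@factorial_functional_widen (size p).+1 p) ?leqnSn //.
rewrite (@factorial_functional_widen (size p) p^`()); last first.
  exact: leq_trans (size_poly _ _) (leq_pred _).
rewrite big_ord_recl fact0 mulr1; congr (_ + _); apply: eq_bigr => i _.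
by rewrite lift0 coef_deriv factSr mulrCA mulr_natl mulrnAl.
Qed.

Lemma deriv_prod (R : comNzRingType) (I : eqType) (s : seq I)
    (F : I -> {poly R}) : uniq s ->
  (\prod_(i <- s) F i)^`() =
  \sum_(i <- s) (F i)^`() * \prod_(j <- s | j != i) F j.
Proof.
elim: s => [|a s IHs] /=; first by rewrite !big_nil -polyC1 derivC.
case/andP=> aNs us; rewrite !big_cons eqxx /= derivM IHs //; congr (_ * _ + _).
  rewrite [in RHS]big_seq_cond [in LHS]big_seq; apply: eq_bigl => j.
  by case: eqP => [->|]; rewrite ?(negPf aNs) ?andbT.
rewrite mulr_sumr [LHS]big_seq [RHS]big_seq; apply: eq_bigr => i si.
rewrite big_cons; case: eqP => [ai|_]; first by rewrite ai si in aNs.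
by rewrite mulrCA.
Qed.

(* [n!] times the polynomial [q_n] above. *)
Definition lag (n : nat) : {poly rat} :=
  if n is n'.+1 then
    \poly_(j < n.+1) (n`!%:R * (-1) ^+ (n + j) *
      (if j is j'.+1 then 'C(n', j')%:R / j`!%:R else 0))
  else 1.

Lemma coef_lagS0 (n : nat) : (lag n.+1)`_0 = 0.
Proof. by rewrite coef_poly mulr0. Qed.

Lemma coef_lagS (n j : nat) :
  (lag n.+1)`_j.+1 = n.+1`!%:R * (-1) ^+ (n + j) * ('C(n, j)%:R / j.+1`!%:R).
Proof.
rewrite coef_poly ltnS addSn addnS !exprS !mulN1r opprK.
by case: ltnP => // nj; rewrite bin_small // mul0r mulr0.
Qed.

Lemma deriv_lagS (n : nat) : (lag n.+1)^`() = n.+1%:R *: (lag n - (lag n)^`()).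
Proof.
apply/polyP => j; rewrite coef_deriv coefZ coefB coef_deriv coef_lagS.
have j1_neq0 : j.+1%:R != 0 :> rat by rewrite pnatr_eq0.
rewrite -[LHS]mulr_natr -[(lag n)`_ _ *+ _]mulr_natr.
(* [lag 0] and constant coefficients do not follow the binomial formula, hence the separate cases;
   the last case is Pascal's rule. *)
case: n => [|n]; last case: j j1_neq0 => [|j] j1_neq0.
- rewrite !coef1 /= mul0r subr0.
  case: j j1_neq0 => [|j] j1_neq0; first by apply/eqP; vm_compute.
  by rewrite bin0n mul0r mulr0 mul0r mulr0.
- rewrite coef_lagS0 coef_lagS !addn0 !bin0 sub0r (factSr n.+1) exprS.
  by field.
- rewrite !coef_lagS binS natrD (factSr n.+1) (factSr j.+1).
  have j2_neq0 : j.+2%:R != 0 :> rat by rewrite pnatr_eq0.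
  have := fact_neq0 j.+1.
  rewrite !addnS !addSn !exprS.
  move: (j.+1`!%:R) (n.+1`!%:R) ((-1) ^+ _) => a b c a_neq0.
  move: (j.+2%:R) j2_neq0 => d d_neq0.
  by field; apply/andP.
Qed.

Section Colouring.

Variables (T : eqType) (I : finType) (f : T -> I).

Definition colour_count (s : seq T) (k : I) : nat :=
  count (fun y => f y == k) s.

Definition lag_prod (s : seq T) : {poly rat} := \prod_k lag (colour_count s k).

Definition lag_prod_deriv (s : seq T) (k : I) : {poly rat} :=
  (lag (colour_count s k))^`() * \prod_(j | j != k) lag (colour_count s j).

Lemma deriv_lag_prod (s : seq T) :
  (lag_prod s)^`() = \sum_k lag_prod_deriv s k.
Proof. by rewrite /lag_prod deriv_prod ?index_enum_uniq. Qed.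

Lemma lag_prod_deriv0 (s : seq T) (k : I) :
  colour_count s k = 0 -> lag_prod_deriv s k = 0.
Proof. by rewrite /lag_prod_deriv => ->; rewrite /= -polyC1 derivC mul0r. Qed.

Lemma coef0_lag_prod (s : seq T) : (0 < size s)%N -> (lag_prod s)`_0 = 0.
Proof.
case: s => // y s _; rewrite /lag_prod (bigD1 (f y)) //= coef0M.
by rewrite /colour_count /= eqxx coef_lagS0 mul0r.
Qed.

(** Removing [y] lowers by one the count of its own colour only, so [deriv_lagS] applies to that
    single factor. *)
Lemma lag_prod_rem (s : seq T) (y : T) : y \in s ->
  (colour_count s (f y))%:R *:
    (lag_prod (rem y s) - lag_prod_deriv (rem y s) (f y)) =
  lag_prod_deriv s (f y).
Proof.
move=> sy; have remE k : colour_count (rem y s) k =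
    (colour_count s k - (f y == k))%N by rewrite /colour_count count_rem sy.
have eq_others : \prod_(j | j != f y) lag (colour_count (rem y s) j) =
    \prod_(j | j != f y) lag (colour_count s j).
  by apply: eq_bigr => j jy; rewrite remE eq_sym (negPf jy) subn0.
rewrite /lag_prod /lag_prod_deriv (bigD1 (f y)) //= eq_others -mulrBl.
rewrite scalerAl remE eqxx subn1.
have : (0 < colour_count s (f y))%N.
  by rewrite -has_count; apply/hasP; exists y.
by case: (colour_count s (f y)) => // c _; rewrite -deriv_lagS.
Qed.

Lemma sum_lag_prod_rem (s : seq T) (A : pred I) :
  \sum_(y <- s | A (f y))
    L (lag_prod (rem y s) - lag_prod_deriv (rem y s) (f y)) =
  \sum_(k | A k) L (lag_prod_deriv s k).
Proof.
rewrite (partition_big f A) //=; apply: eq_bigr => k Ak.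
(* All vertices of colour [k] contribute equally, so their number cancels the inverse supplied by
   [lag_prod_rem]. *)
transitivity (\sum_(y <- s | f y == k)
    (colour_count s k)%:R^-1 * L (lag_prod_deriv s k)).
  rewrite big_seq_cond [RHS]big_seq_cond; apply: eq_big => y.
    by case: eqP => [->|]; rewrite ?Ak ?andbF.
  case/and3P=> sy _ /eqP <-; rewrite -(lag_prod_rem sy) linearZ /= mulKf //.
  by rewrite pnatr_eq0 -lt0n -has_count; apply/hasP; exists y.
rewrite big_const_seq iter_addr_0 -/(colour_count s k) -[LHS]mulr_natl.
(* For an absent colour the count cannot be inverted, but the derivative of [lag 0] vanishes. *)
have [s0|s_neq0] := eqVneq (colour_count s k) 0%N.
  by rewrite s0 lag_prod_deriv0 // linear0 mul0r.
by rewrite mulVKf // pnatr_eq0.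
Qed.

Definition colour_change : rel T := fun x y => f x != f y.

Lemma count_permutations (P : pred (seq T)) (s : seq T) :
  uniq s -> (0 < size s)%N ->
  count P (permutations s) =
  (\sum_(y <- s) count (fun t => P (y :: t)) (permutations (rem y s)))%N.
Proof.
move=> us s_gt0; have /permP -> := permutationsE s_gt0.
rewrite undup_id // count_flatten sumnE !big_map.
by apply: eq_bigr => y _; rewrite count_map.
Qed.

Lemma count_path (x : T) (s : seq T) : uniq s ->
  (count (path colour_change x) (permutations s))%:R =
  L (lag_prod s - lag_prod_deriv s (f x)).
Proof.
have [n] := ubnP (size s); elim: n => // n IHn in x s * => s_n us.
have [s_gt0|] := ltnP 0%N (size s); last first.
  rewrite leqn0 size_eq0 => /eqP ->; rewrite lag_prod_deriv0 // subr0.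
  by rewrite /lag_prod big1 // /L size_poly1 big_ord1 coefC /= fact0 mulr1.
rewrite count_permutations // natr_sum linearB /=.
transitivity (\sum_(y <- s | f y != f x)
    L (lag_prod (rem y s) - lag_prod_deriv (rem y s) (f y))).
  rewrite big_seq [RHS]big_seq_cond [RHS]big_mkcondr.
  apply: eq_bigr => y sy; rewrite -IHn ?rem_uniq //; last first.
    by rewrite size_rem //; case: (s) s_gt0 s_n.
  rewrite /= {1}/colour_change eq_sym; case: ifP => //= _.
  by rewrite count_pred0.
(* The forbidden colour [f x] is exactly the Leibniz term subtracted on the right-hand side. *)
rewrite (sum_lag_prod_rem s (fun k => k != f x)).
rewrite (factorial_functional_deriv (lag_prod s)) coef0_lag_prod // add0r.
by rewrite deriv_lag_prod linear_sum [in RHS](bigD1 (f x)) //= addrAC subrr add0r.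
Qed.

Lemma count_sorted (s : seq T) : uniq s ->
  (count (sorted colour_change) (permutations s))%:R = L (lag_prod s).
Proof.
move=> us; have [s_gt0|] := ltnP 0%N (size s); last first.
  rewrite leqn0 size_eq0 => /eqP ->.
  by rewrite /lag_prod big1 // /L size_poly1 big_ord1 coefC /= fact0 mulr1.
rewrite count_permutations // natr_sum.
under eq_big_seq => y sy do rewrite /= count_path ?rem_uniq //.
rewrite (sum_lag_prod_rem s predT).
rewrite (factorial_functional_deriv (lag_prod s)) coef0_lag_prod // add0r.
by rewrite deriv_lag_prod linear_sum.
Qed.

End Colouring.

Lemma card_directed_hamiltonian_paths (T : finType) (e : rel T) :
  #|directed_hamiltonian_paths e| = count (sorted e) (permutations (enum T)).
Proof.
rewrite -size_filter cardE -(size_map val); apply: perm_size.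
apply: uniq_perm.
- by rewrite map_inj_uniq ?enum_uniq //; apply: val_inj.
- by rewrite filter_uniq ?permutations_uniq.
move=> t; rewrite mem_filter mem_permutations.
apply/mapP/andP => [[p]|[et pt]].
  rewrite mem_enum inE => /andP[ep /forallP cp] ->; split=> //.
  apply/allP => v _ /=; rewrite (eqP (cp v)).
  by rewrite count_uniq_mem ?enum_uniq // mem_enum.
have sz_t : size t == #|T| by rewrite (perm_size pt) -cardE.
exists (Tuple sz_t) => //; rewrite mem_enum inE et /=; apply/forallP => v.
by rewrite (permP pt) count_uniq_mem ?enum_uniq // mem_enum.
Qed.

(** The hypothesis says [q(t) = a p(bt)], and this substitution commutes with powers. *)
Lemma coef_exp_twist (R : comNzRingType) (p q : {poly R}) (a b : R) (m : nat) :
  (forall k, q`_k = a * b ^+ k * p`_k) ->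
  forall k, (q ^+ m)`_k = a ^+ m * b ^+ k * (p ^+ m)`_k.
Proof.
move=> qE; elim: m => [|m IHm] k.
  by rewrite !expr0 coef1 mul1r; case: k => [|k]; rewrite ?mulr1 ?mulr0.
rewrite !exprS !coefM mulr_sumr; apply: eq_bigr => i _; rewrite qE IHm.
have -> : b ^+ k = b ^+ i * b ^+ (k - i) by rewrite -exprD subnKC // -ltnS.
by ring.
Qed.

Theorem proposition6p4 (m n : nat) (hm : (1 <= m)%N) (hn : (1 <= n)%N) :
  (#|directed_hamiltonian_paths (@complete_multipartite m n)|%:R : rat) =
  (n`!)%:R ^+ m * (m`!)%:R * (-1) ^+ (n * m) *
  \sum_(m <= k < (n * m).+1)
    (-1) ^+ k * bell k m (fun i => 'C(n - 1, i - 1)%:R).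
Proof.
rewrite card_directed_hamiltonian_paths.
rewrite (@count_sorted _ _ (@fst 'I_m 'I_n)) ?enum_uniq //.
have -> : lag_prod fst (enum {: 'I_m * 'I_n}) = lag n ^+ m.
  rewrite /lag_prod -[in RHS](card_ord m) -prodr_const.
  apply: eq_bigr => k _; congr lag.
  rewrite /colour_count -sum1_count big_enum_cond /=.
  rewrite (eq_bigl (fun u => (u.1 == k) && predT u.2)); last first.
    by move=> u; rewrite andbT.
  rewrite -(pair_big_dep (fun i => i == k) (fun _ _ => true) (fun _ _ => 1%N)) /=.
  by rewrite big_pred1_eq sum1_card card_ord.
set x : nat -> rat := fun i => _%:R; set p := egf_trunc (n * m) x.
(* Truncating at [n * m] loses nothing, since [C(n-1, k-1) = 0] for [k > n] and [n <= n * m]. *)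
have lagE k : (lag n)`_k = n`!%:R * (-1) ^+ n * (-1) ^+ k * p`_k.
  rewrite /p egf_truncE coefXM; case: n hn @x @p => // n _ x p.
  case: k => [|k]; first by rewrite coef_lagS0 mulr0.
  rewrite coef_lagS coef_poly /x !subn1 /=; case: ltnP => [_|le_k].
    by rewrite !exprS exprD; ring.
  rewrite bin_small; first by rewrite mul0r !mulr0.
  by apply: leq_trans le_k; rewrite leq_pmulr.
have szE : (size (lag n ^+ m) <= (n * m).+1)%N.
  apply: leq_trans (size_poly_exp_leq _ _) _.
  rewrite ltnS leq_mul2r; apply/orP; right; case: (n) hn => // k _.
  by rewrite -subn1 leq_subLR add1n size_poly.
rewrite (factorial_functional_widen szE).
rewrite -(big_mkord predT (fun k => (lag n ^+ m)`_k * k`!%:R)) /=.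
have le_m : (m <= (n * m).+1)%N by rewrite leqW // leq_pmull.
(* The series [p] is divisible by [t], so its [m]-th power has no terms below degree [m]. *)
rewrite (@big_cat_nat _ _ _ m) //= [X in X + _]big1_seq => [|k]; last first.
  rewrite mem_index_iota => /andP[_ /andP[_ km]].
  by rewrite (coef_exp_twist _ lagE) coef_egf_exp km mulr0 mul0r.
rewrite add0r mulr_sumr; apply: eq_big_nat => k /andP[_ k_le].
rewrite (coef_exp_twist _ lagE) exprMn -exprM.
have bellE : (p ^+ m)`_k * k`!%:R = m`!%:R * bell k m x.
  have := bell_generating m x (k_le : (k <= n * m)%N).
  rewrite coefZ -/p => /(canRL (mulVKf (fact_neq0 m))) ->.
  by rewrite mulrA divfK ?fact_neq0.
by rewrite -[LHS]mulrA bellE; ring.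
Qed.
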